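(* Let $f:[0,1]\to\mathbb{R}$ be continuous with $f(0),f(1)\in\mathbb{Z}$, and let $n$ be a positive integer. Then $$d_\infty(f,\mathscr{B}_n)\le \frac{5}{4}\,\omega_f(n^{-1/2})+\rho(f,n),$$ where $$\rho(f,n):=\min_{t\in[0,n/2]\cap\mathbb{Z}}\left\{\max\left(\omega_f\Big(\frac{t}{n}\Big),\ \frac{1}{2(n+1-2t)}\right)+\frac{1}{\sqrt{2(t+1)}}\right\},$$ and moreover $$\rho(f,n)\le \omega_f\Big(\frac{1}{2}n^{-1/3}\Big)+2n^{-1/3}.$$ In particular, $$d_\infty(f,\mathscr{B}_n)\le \frac{9}{4}\,\omega_f(n^{-1/3})+2n^{-1/3}.$$
   Context: All functions are real-valued on $[0,1]$. For $k=0,\dots,n$, let $p_{n,k}(x):=\binom{n}{k}x^k(1-x)^{n-k}$. The Bernstein lattice $\mathscr{B}_n$ is the set of polynomials $\sum_{k=0}^n q_k p_{n,k}$ with $q_0,\dots,q_n\in\mathbb{Z}$ (the lattice generated by $p_{n,0},\dots,p_{n,n}$). For $g,h$ continuous on $[0,1]$, $d_\infty(g,h):=\sup_{x\in[0,1]}|g(x)-h(x)|$, and for a set $S$ of functions, $d_\infty(f,S):=\inf_{P\in S}d_\infty(f,P)$. The modulus of continuity of $f$ on $[0,1]$ is $\omega_f(\delta):=\sup\{|f(x)-f(y)|: x,y\in[0,1],\ |x-y|\le\delta\}$. *)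

(* Defs.v *)
From HB Require Import structures.
From mathcomp Require Import all_boot all_order all_algebra.
From mathcomp Require Import all_classical all_reals all_analysis.
Set Implicit Arguments. Unset Strict Implicit. Unset Printing Implicit Defensive.
Import Order.TTheory GRing.Theory Num.Theory.
Import numFieldNormedType.Exports.
Local Open Scope classical_set_scope.
Local Open Scope ring_scope.

Section Defs.
Variable R : realType.

Definition bern (n k : nat) (x : R) : R :=
  ('C(n, k))%:R * x ^+ k * (1 - x) ^+ (n - k).

Definition bernstein_lattice (n : nat) : set (R -> R) :=
  [set P | exists q : 'I_n.+1 -> int,
      P = (fun x => \sum_(k < n.+1) (q k)%:~R * bern n k x)].

Definition dinf (g h : R -> R) : R :=
  sup [set `|g x - h x| | x in `[0, 1]].

Definition dinf_set (f : R -> R) (S : set (R -> R)) : R :=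
  inf [set dinf f P | P in S].

Definition modcont (f : R -> R) (d : R) : R :=
  sup [set `|f xy.1 - f xy.2| | xy in
        [set xy : R * R | xy.1 \in `[0, 1] /\ xy.2 \in `[0, 1] /\
                          `|xy.1 - xy.2| <= d]].

(* rho(f,n) = min over integers t in [0, n/2] of
   max(omega_f(t/n), 1/(2(n+1-2t))) + 1/sqrt(2(t+1)).
   The index set is finite and nonempty, so its inf is the min. *)
Definition rho_term (f : R -> R) (n t : nat) : R :=
  Num.max (modcont f (t%:R / n%:R)) (1 / (2 * (n%:R + 1 - 2 * t%:R)))
  + 1 / Num.sqrt (2 * (t%:R + 1)).

Definition rho (f : R -> R) (n : nat) : R :=
  inf [set rho_term f n t | t in [set t : nat | (2 * t <= n)%N]].

End Defs.

(* Main.v *)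
(** The Bernstein polynomial [sum_k f(k/n) p_{n,k}] is within
    [5/4 omega_f(n^(-1/2))] of [f], because [|f x - f y|] is at most
    [(1 + (|x - y| / d)^2) omega_f(d)] and the binomial variance is at most
    [n / 4].  Its coefficients are then rounded: for [k < t] to [f 0], for
    [k > n - t] to [f 1], and in the middle block so that all partial sums of the
    rounding errors stay below [1/2] and the total error vanishes, after a common
    shift of size at most [1 / (2 (n + 1 - 2t))].  Summation by parts bounds the
    middle contribution by half the variation of [k |-> p_{n,k}(x)] over the
    block.  By unimodality this is at most the maximum of [p_{n,k}] there, which
    is compared with a central binomial coefficient.  For [t = 0] that maximum
    is too large, but rounding every coefficient to a nearest integer costs only
    [1/2]. *)
Require Import Defs.
From HB Require Import structures.
From mathcomp Require Import all_boot all_order all_algebra.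
From mathcomp Require Import all_classical all_reals all_analysis.
From mathcomp Require Import zify ring lra.
Set Implicit Arguments. Unset Strict Implicit. Unset Printing Implicit Defensive.
Import Order.TTheory GRing.Theory Num.Theory.
Import numFieldNormedType.Exports.
Local Open Scope classical_set_scope.
Local Open Scope ring_scope.

(** * Bernstein basis: positivity, recursion and moments *)

Lemma bern_ge0 (R : realType) (n k : nat) (x : R) :
  0 <= x <= 1 -> 0 <= bern n k x.
Proof.
by move=> /andP[x0 x1]; rewrite /bern !mulr_ge0 ?exprn_ge0 ?ler0n ?subr_ge0.
Qed.

Lemma bern_small (R : realType) (n k : nat) (x : R) : (n < k)%N -> bern n k x = 0.
Proof. by move=> nk; rewrite /bern bin_small// !mul0r. Qed.

Lemma bern_sum (R : realType) (n : nat) (x : R) :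
  \sum_(k < n.+1) bern n k x = 1.
Proof.
transitivity (((1 - x) + x) ^+ n); last by rewrite subrK expr1n.
rewrite exprDn; apply: eq_bigr => i _.
by rewrite /bern -mulrA mulr_natl [x ^+ i * _]mulrC.
Qed.

Lemma bernS0 (R : realType) (n : nat) (x : R) :
  bern n.+1 0 x = (1 - x) * bern n 0 x.
Proof. by rewrite /bern !bin0 !subn0 !expr0 exprS; ring. Qed.

Lemma bernSS (R : realType) (n k : nat) (x : R) :
  bern n.+1 k.+1 x = (1 - x) * bern n k.+1 x + x * bern n k x.
Proof.
rewrite /bern binS natrD subSS exprS.
have [kn|nk] := ltnP k n.
  by rewrite -(subnSK kn) exprS; ring.
by rewrite bin_small//; ring.
Qed.

(** Pascal's rule, read as conditioning on the last of [n.+1] Bernoulli trials: a success, of weight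
    [x], shifts the argument of [g]. *)
Lemma bern_sumS (R : realType) (n : nat) (x : R) (g : nat -> R) :
  \sum_(k < n.+2) g k * bern n.+1 k x =
  (1 - x) * \sum_(k < n.+1) g k * bern n k x +
  x * \sum_(k < n.+1) g k.+1 * bern n k x.
Proof.
have -> : \sum_(k < n.+1) g k * bern n k x = \sum_(k < n.+2) g k * bern n k x.
  by rewrite [RHS]big_ord_recr/= bern_small// mulr0 addr0.
rewrite !(big_ord_recl n.+1)/= bernS0 mulrDr -addrA mulrCA; congr (_ + _).
rewrite !mulr_sumr -big_split; apply: eq_bigr => i _ /=.
by rewrite /bump/= add1n bernSS; ring.
Qed.

(** The centre [c] stays arbitrary because the induction step uses the hypothesis at both [c] and
    [c - 1]. *)
Lemma bern_second_moment (R : realType) (n : nat) (x c : R) :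
  \sum_(k < n.+1) (k%:R - c) ^+ 2 * bern n k x =
  n%:R * x * (1 - x) + (n%:R * x - c) ^+ 2.
Proof.
elim: n c => [|n IH] c.
  rewrite big_ord_recl big_ord0 /bern/= bin0 !expr0. ring.
rewrite (bern_sumS n x (fun k => (k%:R - c) ^+ 2)) IH.
under [X in _ + x * X]eq_bigr => i _.
  have -> : i.+1%:R - c = i%:R - (c - 1) by rewrite -natr1; ring.
  over.
by rewrite IH -natr1; ring.
Qed.

Lemma bern_variance (R : realType) (n : nat) (x : R) : (0 < n)%N ->
  \sum_(k < n.+1) (x - k%:R / n%:R) ^+ 2 * bern n k x = x * (1 - x) / n%:R.
Proof.
move=> n0; have nN0 : n%:R != 0 :> R by rewrite pnatr_eq0 -lt0n.
have := bern_second_moment n x (n%:R * x); rewrite subrr expr0n addr0 => E.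
transitivity (n%:R ^- 2 * (n%:R * x * (1 - x))); last by field.
by rewrite -E mulr_sumr; apply: eq_bigr => i _; field.
Qed.

(** * The modulus of continuity *)

Lemma modcont_has_sup (R : realType) (f : R -> R) (d : R) :
  {within `[0, 1], continuous f} -> 0 <= d ->
  has_sup [set `|f xy.1 - f xy.2| | xy in
        [set xy : R * R | xy.1 \in `[0, 1] /\ xy.2 \in `[0, 1] /\
                          `|xy.1 - xy.2| <= d]].
Proof.
move=> cf d0; split.
  exists `|f 0 - f 0|, (0, 0) => //=.
  by rewrite subrr normr0; split => //; rewrite in_itv/= lexx ler01.
have [M _ fM] := EVT_max ler01 cf; have [m _ fm] := EVT_min ler01 cf.
exists (f M - f m) => _ [[x y] /= [x01 [y01 _]] <-].
have := fM _ x01; have := fM _ y01; have := fm _ x01; have := fm _ y01.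
by move=> ? ? ? ?; rewrite ler_norml; apply/andP; split; lra.
Qed.

Lemma le_modcont (R : realType) (f : R -> R) (d x y : R) :
  {within `[0, 1], continuous f} -> 0 <= x <= 1 -> 0 <= y <= 1 ->
  `|x - y| <= d -> `|f x - f y| <= modcont f d.
Proof.
move=> cf x01 y01 xyd.
have d0 : 0 <= d by apply: le_trans xyd.
apply: ub_le_sup; first exact: (modcont_has_sup cf d0).2.
by exists (x, y) => //=; split=> //; rewrite in_itv/=.
Qed.

Lemma modcont_ge0 (R : realType) (f : R -> R) (d : R) :
  {within `[0, 1], continuous f} -> 0 <= d -> 0 <= modcont f d.
Proof.
move=> cf d0; rewrite (_ : 0 = `|f 0 - f 0|); last by rewrite subrr normr0.
by apply: le_modcont => //; rewrite ?lexx ?ler01// subrr normr0.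
Qed.

Lemma modcont_le (R : realType) (f : R -> R) (d e : R) :
  {within `[0, 1], continuous f} -> 0 <= d -> d <= e ->
  modcont f d <= modcont f e.
Proof.
move=> cf d0 de; apply: ge_sup; first exact: (modcont_has_sup cf d0).1.
move=> _ [[x y] /= [x01 [y01 xyd]] <-].
rewrite !in_itv/= in x01 y01.
by apply: le_modcont => //; apply: le_trans de.
Qed.

(** Walk from [y] to [x] in [m.+1] equal steps of length at most [d]; the intermediate points stay
    in [[0, 1]] by convexity. *)
Lemma modcont_mul (R : realType) (f : R -> R) (d : R) (m : nat) (x y : R) :
  {within `[0, 1], continuous f} -> 0 <= x <= 1 -> 0 <= y <= 1 ->
  `|x - y| <= m.+1%:R * d -> `|f x - f y| <= m.+1%:R * modcont f d.
Proof.
move=> cf + y01; elim: m x => [|m IH] x x01 xy.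
  by rewrite mul1r; apply: le_modcont => //; rewrite -[d]mul1r.
have m1 : 0 < m.+1%:R :> R by rewrite ltr0n.
have m2 : 0 < m.+2%:R :> R by rewrite ltr0n.
have E2 : m.+2%:R = m.+1%:R + 1 :> R by rewrite -natr1.
pose z := y + (x - y) * (m.+1%:R / m.+2%:R).
have zy : `|z - y| <= m.+1%:R * d.
  rewrite /z addrAC subrr add0r normrM (ger0_norm (divr_ge0 _ _))//.
  by rewrite mulrCA ler_pM2l// ler_pdivrMr// mulrC.
have xz : `|x - z| <= d.
  have -> : x - z = (x - y) / m.+2%:R.
    by move: (lt0r_neq0 m2); rewrite /z E2; move: m.+1%:R => q ?; field.
  by rewrite normrM normfV (ger0_norm (ltW m2)) ler_pdivrMr// mulrC.
have t01 : 0 <= (m.+1%:R / m.+2%:R : R) <= 1.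
  by rewrite divr_ge0//= ler_pdivrMr// mul1r ler_nat.
have z01 : 0 <= z <= 1.
  rewrite /z; move: t01 x01 y01; set t := _ / _.
  by move=> /andP[? ?] /andP[? ?] /andP[? ?]; apply/andP; split; nra.
rewrite E2 mulrDl mul1r [leRHS]addrC.
have -> : f x - f y = (f x - f z) + (f z - f y) by ring.
by rewrite (le_trans (ler_normD _ _))// lerD ?IH// le_modcont.
Qed.

(** With [u = |x - y| / d], [floor u + 1] steps suffice, and [floor u <= (floor u)^2 <= u^2] because
    [floor u] is a natural number. The square lets the variance enter. *)
Lemma modcont_quad (R : realType) (f : R -> R) (d x y : R) :
  {within `[0, 1], continuous f} -> 0 < d -> 0 <= x <= 1 -> 0 <= y <= 1 ->
  `|f x - f y| <= (1 + (x - y) ^+ 2 / d ^+ 2) * modcont f d.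
Proof.
move=> cf d0 x01 y01; pose u := `|x - y| / d.
have u0 : 0 <= u by rewrite divr_ge0// ltW.
have /andP[mu um] := truncn_itv u0.
have xy : `|x - y| <= (Num.truncn u).+1%:R * d by rewrite -ler_pdivrMr// ltW.
apply: le_trans (modcont_mul cf x01 y01 xy) _.
apply: ler_wpM2r; first by rewrite modcont_ge0// ltW.
rewrite -natr1 [leLHS]addrC lerD2l.
have -> : (x - y) ^+ 2 / d ^+ 2 = u ^+ 2.
  by rewrite /u expr_div_n real_normK// num_real.
have le_sqr (k : nat) : k%:R <= k%:R ^+ 2 :> R.
  by rewrite -natrX ler_nat; case: k => // k; rewrite leq_pmull.
by rewrite (le_trans (le_sqr _))// lerXn2r ?nnegrE.
Qed.

(** * Approximation by the Bernstein polynomial *)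

Lemma bernstein_approx (R : realType) (f : R -> R) (n : nat) (x : R) :
  {within `[0, 1], continuous f} -> (0 < n)%N -> 0 <= x <= 1 ->
  `|f x - \sum_(k < n.+1) f (k%:R / n%:R) * bern n k x|
    <= 5 / 4 * modcont f (1 / Num.sqrt n%:R).
Proof.
move=> cf n0 x01; set w := modcont _ _.
have n0' : 0 < n%:R :> R by rewrite ltr0n.
have s0 : 0 < 1 / Num.sqrt n%:R :> R by rewrite divr_gt0// sqrtr_gt0.
have s2 : (1 / Num.sqrt n%:R) ^+ 2 = n%:R^-1 :> R.
  by rewrite div1r exprVn sqr_sqrtr// ltW.
have w0 : 0 <= w by rewrite modcont_ge0// ltW.
have -> : f x - \sum_(k < n.+1) f (k%:R / n%:R) * bern n k x =
    \sum_(k < n.+1) (f x - f (k%:R / n%:R)) * bern n k x.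
  rewrite -[f x]mulr1 -{1}(bern_sum n x) mulr_sumr -sumrB.
  by apply: eq_bigr => i _; ring.
apply: le_trans (ler_norm_sum _ _ _) _.
apply: (@le_trans _ _ (\sum_(k < n.+1)
    (1 + (x - k%:R / n%:R) ^+ 2 * n%:R) * w * bern n k x)).
  apply: ler_sum => k _.
  rewrite normrM (ger0_norm (bern_ge0 _ _ x01)).
  apply: ler_wpM2r; first exact: bern_ge0.
  have k01 : 0 <= (k%:R / n%:R : R) <= 1.
    by rewrite divr_ge0//= ler_pdivrMr// mul1r ler_nat -ltnS ltn_ord.
  have := modcont_quad cf s0 x01 k01.
  by rewrite s2 invrK.
have -> : \sum_(k < n.+1) (1 + (x - k%:R / n%:R) ^+ 2 * n%:R) * w * bern n k x
    = w * \sum_(k < n.+1) bern n k x +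
      n%:R * w * \sum_(k < n.+1) (x - k%:R / n%:R) ^+ 2 * bern n k x.
  by rewrite !mulr_sumr -big_split; apply: eq_bigr => i _ /=; ring.
(* The choice [d = n^(-1/2)] makes the factor [1 / d^2 = n] cancel the [1 / n] of the variance; then
   [x (1 - x) <= 1 / 4] gives the constant [5 / 4]. *)
rewrite bern_sum bern_variance//.
have -> : w * 1 + n%:R * w * (x * (1 - x) / n%:R) = (1 + x * (1 - x)) * w.
  by field; rewrite gt_eqF.
by apply: ler_wpM2r => //; have := sqr_ge0 (x - 1 / 2); nra.
Qed.

(** * Rounding with controlled partial sums *)

Definition nearest_int (R : realType) (x : R) : int := Num.floor (x + 1 / 2).

Lemma nearest_intP (R : realType) (x : R) :
  `|x - (nearest_int x)%:~R| <= 1 / 2.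
Proof.
have := floor_itv (x + 1 / 2); rewrite -/(nearest_int x) intrD.
by move=> /andP[? ?]; rewrite ler_norml; apply/andP; split; lra.
Qed.

Lemma nearest_int_id (R : realType) (z : int) : nearest_int (z%:~R : R) = z.
Proof. by apply: floor_def; rewrite intrD; lra. Qed.

Lemma sum_by_parts (R : realType) (e w : nat -> R) (m : nat) :
  \sum_(k < m.+1) e k * w k = (\sum_(k < m.+1) e k) * w m +
    \sum_(k < m) (\sum_(j < k.+1) e j) * (w k - w k.+1).
Proof.
elim: m => [|m IH]; first by rewrite !big_ord_recr !big_ord0/=; ring.
rewrite big_ord_recr/= IH [X in _ = _ + X]big_ord_recr/=.
by rewrite [X in _ = X * _ + _]big_ord_recr/=; ring.
Qed.

(* [q] is chosen so that its partial sums are the nearest integers to those of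
   [a k - delta], where [delta] makes the total an integer. *)
Lemma rounding (R : realType) (a : nat -> R) (m : nat) :
  exists q : nat -> int, forall w : nat -> R, (forall k, 0 <= w k) ->
    `|\sum_(k < m.+1) (a k - (q k)%:~R) * w k| <=
      1 / (2 * m.+1%:R) * \sum_(k < m.+1) w k +
      1 / 2 * \sum_(k < m) `|w k - w k.+1|.
Proof.
pose A := \sum_(k < m.+1) a k.
pose delta := (A - (nearest_int A)%:~R) / m.+1%:R.
pose B k := \sum_(j < k) (a j - delta).
pose Q k := nearest_int (B k).
have Q0 : Q 0%N = 0 by rewrite /Q /B big_ord0 (nearest_int_id R 0).
have m1 : 0 < m.+1%:R :> R by rewrite ltr0n.
have Bm : B m.+1 = (nearest_int A)%:~R.
  rewrite /B sumrB -/A sumr_const card_ord -mulr_natr /delta divfK ?gt_eqF//.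
  by ring.
have Qm : (Q m.+1)%:~R = B m.+1 by rewrite /Q Bm nearest_int_id.
exists (fun k => Q k.+1 - Q k) => w w0.
pose e k := a k - delta - (Q k.+1 - Q k)%:~R.
have sume k : \sum_(j < k) e j = B k - (Q k)%:~R.
  elim: k => [|k IH]; first by rewrite Q0 /B !big_ord0 subrr.
  by rewrite big_ord_recr/= IH /B big_ord_recr/= /e intrD intrN; ring.
have -> : \sum_(k < m.+1) (a k - (Q k.+1 - Q k)%:~R) * w k =
    delta * \sum_(k < m.+1) w k + \sum_(k < m.+1) e k * w k.
  by rewrite mulr_sumr -big_split; apply: eq_bigr => k _; rewrite /e/=; ring.
apply: le_trans (ler_normD _ _) _; apply: lerD.
  rewrite normrM [X in _ * X <= _]ger0_norm ?sumr_ge0//.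
  apply: ler_wpM2r; first by rewrite sumr_ge0.
  rewrite /delta normrM normfV (ger0_norm (ltW m1)).
  rewrite ler_pdivrMr// (le_trans (nearest_intP _))//.
  by rewrite le_eqVlt; apply/orP; left; apply/eqP; field; rewrite gt_eqF.
(* The total of [e] vanishes, so the boundary term drops out; every other partial sum is a
   nearest-integer error, at most [1 / 2]. *)
rewrite sum_by_parts sume Qm subrr mul0r add0r.
apply: le_trans (ler_norm_sum _ _ _) _; rewrite mulr_sumr; apply: ler_sum => k _.
by rewrite sume normrM ler_wpM2r// nearest_intP.
Qed.

(** * Unimodality and total variation *)

(** The variation telescopes on each side of the peak, which within the range sits at [minn c m];
    the end values only help, being nonnegative. *)
Lemma unimodal_variation (R : realType) (w : nat -> R) (c m : nat) (M : R) :
  (forall k, 0 <= w k) ->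
  (forall k, (k < c)%N -> w k <= w k.+1) ->
  (forall k, (c <= k)%N -> w k.+1 <= w k) ->
  (forall k, (k <= m)%N -> w k <= M) ->
  \sum_(k < m) `|w k - w k.+1| <= 2 * M.
Proof.
move=> w0 up down wM.
suff -> : \sum_(k < m) `|w k - w k.+1| = 2 * w (minn c m) - w 0%N - w m.
  by have := wM _ (geq_minr c m); have := w0 0%N; have := w0 m; lra.
elim: m {wM} => [|m IH]; first by rewrite big_ord0 minn0; ring.
rewrite big_ord_recr/= IH; case: (ltnP m c) => [mc|cm].
  rewrite (minn_idPr mc) distrC ger0_norm ?subr_ge0 ?up//.
  by ring.
rewrite (minn_idPl (leqW cm)) ger0_norm ?subr_ge0 ?down//.
by ring.
Qed.

(** For [x] in [[0, 1]], the sign of a consecutive difference is governed by [(n + 1) x - (k + 1)],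
    which decreases in [k]; this is the source of unimodality. *)
Lemma bern_diff (R : realType) (n k : nat) (x : R) : (k < n)%N ->
  k.+1%:R * (bern n k.+1 x - bern n k x) =
  'C(n, k)%:R * x ^+ k * (1 - x) ^+ (n - k.+1) * (n.+1%:R * x - k.+1%:R).
Proof.
move=> kn; have := congr1 (fun i : nat => i%:R : R) (mul_bin_left n k).
rewrite /= !natrM natrB ?(ltnW kn)// => E.
rewrite /bern mulrBr -(subnSK kn) !exprS !mulrA E -!natr1.
by ring.
Qed.

Lemma bern_unimodal (R : realType) (n : nat) (x : R) : 0 <= x <= 1 ->
  exists c, (forall k, (k < c)%N -> bern n k x <= bern n k.+1 x) /\
            (forall k, (c <= k)%N -> bern n k.+1 x <= bern n k x).
Proof.
move=> x01; have /andP[x0 x1] := x01.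
have y0 : 0 <= n.+1%:R * x by rewrite mulr_ge0.
have cst_ge0 k : 0 <= 'C(n, k)%:R * x ^+ k * (1 - x) ^+ (n - k.+1).
  by rewrite !mulr_ge0 ?exprn_ge0 ?ler0n ?subr_ge0.
(* The cap at [n] matters at [x = 1], where the floor is [n + 1] although [bern n n.+1] is already
   zero. *)
exists (minn (Num.truncn (n.+1%:R * x)) n); split=> k.
  rewrite leq_min => /andP[kx kn]; rewrite -subr_ge0.
  rewrite -(@pmulr_rge0 _ k.+1%:R) ?ltr0n// bern_diff// mulr_ge0//.
  by rewrite subr_ge0 -truncn_gt_nat.
rewrite geq_min; have [nk _|kn] := leqP n k.
  by rewrite (bern_small (k := k.+1))// bern_ge0.
rewrite orbF => kx; rewrite -subr_le0.
rewrite -(@pmulr_rle0 _ k.+1%:R) ?ltr0n// bern_diff// mulr_ge0_le0//.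
by rewrite subr_le0 ltW// -truncn_lt_nat.
Qed.

(** * Upper bounds for the basis polynomials away from the ends *)

(** AM-GM applied to [k.+1] copies of [x / k.+1] and [j.+1] copies of [(1 - x) / j.+1], whose sum is
    1. *)
Lemma weighted_AGM (R : realType) (j k : nat) (x : R) : 0 <= x <= 1 ->
  x ^+ k.+1 * (1 - x) ^+ j.+1 <=
  (k.+1%:R / (k.+1 + j.+1)%:R) ^+ k.+1 * (j.+1%:R / (k.+1 + j.+1)%:R) ^+ j.+1.
Proof.
move=> /andP[x0 x1].
have k0 : 0 < k.+1%:R :> R by rewrite ltr0n.
have j0 : 0 < j.+1%:R :> R by rewrite ltr0n.
pose E (i : 'I_(k.+1 + j.+1)) : R :=
  if (i < k.+1)%N then x / k.+1%:R else (1 - x) / j.+1%:R.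
have El i : E (lshift j.+1 i) = x / k.+1%:R by rewrite /E /= ltn_ord.
have Er i : E (rshift k.+1 i) = (1 - x) / j.+1%:R.
  by rewrite /E /= ltnNge leq_addr.
have E0 : {in 'I_(k.+1 + j.+1), forall i, 0 <= E i}.
  move=> i _; rewrite /E.
  by case: ifP => _; rewrite divr_ge0 ?ler0n// subr_ge0.
have [+ _] := leif_AGM E0; rewrite !big_split_ord/=.
under eq_bigr do rewrite El.
under [X in _ * X <= _]eq_bigr do rewrite Er.
under [X in _ <= ((X + _) / _) ^+ _]eq_bigr do rewrite El.
under [X in _ <= ((_ + X) / _) ^+ _]eq_bigr do rewrite Er.
rewrite !prodr_const !sumr_const !card_ord.
rewrite -(mulr_natr (x / _)) -(mulr_natr ((1 - x) / _)) !divfK ?gt_eqF//.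
rewrite [x + _]addrC subrK mul1r => AGM.
have c0 : 0 < k.+1%:R ^+ k.+1 * j.+1%:R ^+ j.+1 :> R.
  by rewrite mulr_gt0// exprn_gt0.
have := ler_wpM2r (ltW c0) AGM.
rewrite !expr_div_n exprVn exprD.
have kN : k.+1%:R ^+ k.+1 != 0 :> R by rewrite expf_neq0 ?gt_eqF.
have jN : j.+1%:R ^+ j.+1 != 0 :> R by rewrite expf_neq0 ?gt_eqF.
have nN m : (k.+1 + j.+1)%:R ^+ m != 0 :> R by rewrite expf_neq0 ?pnatr_eq0.
move: (_ ^+ k.+1) (_ ^+ j.+1) kN jN (x ^+ _) ((1 - x) ^+ _) (nN k.+1) (nN j.+1).
move=> K J KN JN u v; move: (_ ^+ k.+1) (_ ^+ j.+1) => p q pN qN.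
have -> : u / K * (v / J) * (K * J) = u * v by field; rewrite ?KN ?JN.
have -> // : (p * q)^-1 * (K * J) = K / p * (J / q).
by field; rewrite ?pN ?qN.
Qed.

Lemma bern_le_mode (R : realType) (n k : nat) (x : R) :
  (0 < k < n)%N -> 0 <= x <= 1 -> bern n k x <= bern n k (k%:R / n%:R).
Proof.
case: k => [//|k] /andP[_ kn] x01.
have [j nE] : exists j, n = (k.+1 + j.+1)%N.
  by exists (n - k.+1).-1; rewrite prednK ?subn_gt0// subnKC// ltnW.
rewrite /bern -!mulrA ler_wpM2l ?ler0n//.
have -> : 1 - k.+1%:R / n%:R = j.+1%:R / n%:R :> R.
  have : k.+1%:R + j.+1%:R != 0 :> R by rewrite -natrD pnatr_eq0.
  by rewrite nE natrD; move: k.+1%:R j.+1%:R => a b ab; field.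
by rewrite nE addKn weighted_AGM.
Qed.

(* At the mode [x = k / (n + 1)] the factor [1 - x] absorbs the change of the
   binomial coefficient. *)
Lemma bernS_mode (R : realType) (n k : nat) : (k <= n)%N ->
  bern n.+1 k (k%:R / n.+1%:R) = bern n k (k%:R / n.+1%:R) :> R.
Proof.
move=> kn; have := congr1 (fun i : nat => i%:R : R) (mul_bin_down n.+1 k).
rewrite /= !natrM => E.
have n1 : n.+1%:R != 0 :> R by rewrite pnatr_eq0.
rewrite /bern subSn// exprS.
have -> : 1 - k%:R / n.+1%:R = (n.+1 - k)%:R / n.+1%:R :> R.
  by rewrite natrB ?leqW// mulrBl divff.
move: (_ ^+ (n - k)) (_ ^+ k) => u v.
have -> : 'C(n.+1, k)%:R * v * ((n.+1 - k)%:R / n.+1%:R * u) =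
   ((n.+1 - k)%:R * 'C(n.+1, k)%:R) / n.+1%:R * v * u by ring.
by rewrite -E (mulrC n.+1%:R) mulfK.
Qed.

(** Induction on [d]: moving [x] to the mode can only increase the value, and at the mode the degree
    drops by one without changing it. Since [x] is universally quantified, the hypothesis applies at
    the new point. For [d = 0] the bound is [x (1 - x) <= 1 / 4]. *)
Lemma bern_le_central (R : realType) (k d : nat) (x : R) :
  (0 < k)%N -> 0 <= x <= 1 ->
  bern (k + k + d) k x <= 'C(k + k, k)%:R / 4 ^+ k.
Proof.
move=> k0; elim: d x => [|d IH] x x01.
  rewrite addn0 /bern addnK -mulrA ler_wpM2l ?ler0n// -exprMn -exprVn.
  have /andP[x0 x1] := x01.
  rewrite lerXn2r ?nnegrE ?invr_ge0// ?mulr_ge0 ?subr_ge0//.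
  by have := sqr_ge0 (x - 1 / 2); lra.
rewrite addnS; apply: le_trans (bern_le_mode _ x01) _; first by rewrite k0/=; lia.
rewrite bernS_mode; last by lia.
by apply: IH; rewrite divr_ge0//= ler_pdivrMr ?ltr0n// mul1r ler_nat; lia.
Qed.

(** A Wallis-type bound, with equality at [k = 1] and false at [k = 0]; the latter is why [t = 0] is
    treated apart later. *)
Lemma central_binomial_sqr (k : nat) : (0 < k)%N ->
  (2 * k.+1 * 'C(k + k, k) ^ 2 <= 16 ^ k)%N.
Proof.
case: k => [//|k _]; elim: k => [//|k]; move: k.+1 (ltn0Sn k) => m m0 IH.
have E1 := mul_bin_diag (m.+1 + m.+1) m.
have E2 := mul_bin_down (m + m).+1 m.
rewrite addSn addnS /= in E1 E2 *.
move: 'C((m + m).+2, m.+1) 'C((m + m).+1, m) 'C(m + m, m) E1 E2 IH.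
move=> u v w E1 E2 IH.
(* The ratio of successive central binomial coefficients; the induction step then reduces to the
   polynomial inequality [H]. *)
have uE : (m.+1 * u = 2 * (2 * m + 1) * w)%N by nia.
rewrite -(@leq_pmul2l (m.+1 ^ 2))//.
have -> : (m.+1 ^ 2 * (2 * m.+2 * u ^ 2) = 2 * m.+2 * (m.+1 * u) ^ 2)%N by ring.
rewrite uE.
have H : (m.+2 * (2 * m + 1) ^ 2 <= 4 * m.+1 ^ 3)%N by rewrite !expnS !expn0; nia.
have H1 := leq_mul H (leqnn (8 * w ^ 2)).
have H2 := leq_mul (leqnn (16 * m.+1 ^ 2)) IH.
have -> : (2 * m.+2 * (2 * (2 * m + 1) * w) ^ 2 =
  m.+2 * (2 * m + 1) ^ 2 * (8 * w ^ 2))%N by ring.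
apply: leq_trans H1 _.
have -> : (4 * m.+1 ^ 3 * (8 * w ^ 2) = 16 * m.+1 ^ 2 * (2 * m.+1 * w ^ 2))%N
  by ring.
by apply: leq_trans H2 _; rewrite (expnS 16) mulnA leq_mul2r [(16 * _)%N]mulnC leqnn orbT.
Qed.

Lemma central_binomial_le (R : realType) (k : nat) : (0 < k)%N ->
  'C(k + k, k)%:R / 4 ^+ k <= 1 / Num.sqrt (2 * k.+1%:R) :> R.
Proof.
move=> k0; have := central_binomial_sqr k0; set c := 'C(_, _) => H.
have s0 : 0 < 2 * k.+1%:R :> R by rewrite mulr_gt0// ltr0n.
have r0 : 0 < Num.sqrt (2 * k.+1%:R) :> R by rewrite sqrtr_gt0.
have p0 : 0 < 4 ^+ k :> R by rewrite exprn_gt0.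
rewrite ler_pdivrMr// mulrAC ler_pdivlMr// mul1r.
rewrite -(@ler_pXn2r _ 2) ?nnegrE ?mulr_ge0 ?(ltW r0) ?(ltW p0)//.
rewrite exprMn sqr_sqrtr ?(ltW s0)// -exprM mulnC exprM mulrC.
have -> : 4 ^+ 2 = 16%:R :> R by rewrite -natrX.
by move: H; rewrite -(@ler_nat R) !natrM !natrX.
Qed.

Lemma bern_sym (R : realType) (n k : nat) (x : R) : (k <= n)%N ->
  bern n (n - k) (1 - x) = bern n k x.
Proof. by move=> kn; rewrite /bern bin_sub// subKn// subKr mulrAC. Qed.

(** The symmetry [k -> n - k], [x -> 1 - x] reduces to [2k <= n]. The central bound then decreases
    in [k], so [k >= t] yields the bound at [t]. *)
Lemma bern_le_bulk (R : realType) (n t k : nat) (x : R) :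
  (0 < t)%N -> (t <= k)%N -> (k + t <= n)%N -> 0 <= x <= 1 ->
  bern n k x <= 1 / Num.sqrt (2 * t.+1%:R).
Proof.
move=> t0 + + x01; wlog kn : k x x01 / (k + k <= n)%N => [hw|] tk ktn.
  have [|nk] := leqP (k + k) n; first by move=> ?; apply: hw.
  rewrite -bern_sym; last by lia.
  have /andP[x0 x1] := x01.
  by apply: hw; rewrite ?subr_ge0 ?gerBl ?x0 ?x1//; lia.
have k0 : (0 < k)%N by apply: leq_trans tk.
rewrite -(subnKC kn); apply: le_trans (bern_le_central _ k0 x01) _.
apply: le_trans (central_binomial_le R k0) _.
have s0 i : 0 < 2 * i.+1%:R :> R by rewrite mulr_gt0// ltr0n.
rewrite !div1r lef_pV2 ?posrE ?sqrtr_gt0// ler_sqrt//.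
by rewrite ler_pM2l// ler_nat.
Qed.

(** * Rounding the coefficients of the Bernstein polynomial *)

Lemma middle_rounding (R : realType) (n t : nat) (a : nat -> R) :
  (0 < t)%N -> (2 * t <= n)%N ->
  exists q : nat -> int, forall x : R, 0 <= x <= 1 ->
    `|\sum_(t <= k < (n - t).+1) (a k - (q k)%:~R) * bern n k x| <=
      1 / (2 * (n%:R + 1 - 2 * t%:R)) * \sum_(t <= k < (n - t).+1) bern n k x +
      1 / Num.sqrt (2 * (t%:R + 1)).
Proof.
move=> t0 tn; pose m := (n - 2 * t)%N.
have shift (F : nat -> R) :
    \sum_(t <= k < (n - t).+1) F k = \sum_(k < m.+1) F (k + t)%N.
  rewrite -[X in \sum_(X <= _ < _) _]add0n big_addn.
  by rewrite (_ : (n - t).+1 - t = m.+1)%N ?big_mkord// /m; lia.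
have [q qP] := rounding (fun k => a (k + t)%N) m.
exists (fun k => q (k - t)%N) => x x01.
rewrite !shift; under eq_bigr do rewrite addnK.
have w0 k : 0 <= bern n (k + t) x by exact: bern_ge0.
apply: le_trans (qP (fun k => bern n (k + t) x) w0) _.
have -> : m.+1%:R = n%:R + 1 - 2 * t%:R :> R.
  by rewrite -natr1 natrB// natrM; ring.
rewrite lerD2l; have [c [up down]] := bern_unimodal n x01.
have V : \sum_(k < m) `|bern n (k + t) x - bern n (k.+1 + t) x| <=
    2 * (1 / Num.sqrt (2 * (t%:R + 1))).
  (* The subtraction is truncated: when the peak [c] lies below the block, [c - t] is 0 and the
     shifted sequence only decreases. *)
  apply: (unimodal_variation (w := fun k => bern n (k + t) x) (c := c - t)) => //.
  - by move=> k kc; rewrite addSn up//; lia.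
  - by move=> k ck; rewrite addSn down//; lia.
  - by move=> k km; rewrite natr1 bern_le_bulk//; rewrite /m in km; lia.
by move: V; rewrite /=; lra.
Qed.

Lemma lattice_rounding (R : realType) (f : R -> R) (n t : nat) :
  {within `[0, 1], continuous f} ->
  f 0 \is a Num.int -> f 1 \is a Num.int -> (0 < n)%N -> (2 * t <= n)%N ->
  exists q : nat -> int, forall x : R, 0 <= x <= 1 ->
    `|\sum_(k < n.+1) (f (k%:R / n%:R) - (q k)%:~R) * bern n k x|
      <= rho_term f n t.
Proof.
move=> cf f0 f1 n0 tn; rewrite /rho_term.
set A := modcont _ _; set B := 1 / (2 * _); set M := 1 / Num.sqrt _.
have n0' : 0 < n%:R :> R by rewrite ltr0n.
have B0 : 0 <= B.
  have : (2 * t)%:R <= n%:R :> R by rewrite ler_nat.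
  by rewrite natrM => H; rewrite divr_ge0//; lra.
have [t0|t0] := posnP t.
  exists (fun k => nearest_int (f (k%:R / n%:R))) => x x01.
  apply: (@le_trans _ _ (1 / 2)).
    rewrite -[leRHS]mulr1 -[X in _ <= _ * X](bern_sum n x) mulr_sumr.
    apply: le_trans (ler_norm_sum _ _ _) _; apply: ler_sum => k _.
    rewrite normrM (ger0_norm (bern_ge0 _ _ x01)).
    by apply: ler_wpM2r; [exact: bern_ge0 | exact: nearest_intP].
  apply: (@le_trans _ _ M); last by rewrite lerDr le_max B0 orbT.
  (* For [t = 0] the last term of [rho_term] is [1 / sqrt 2], which already exceeds [1 / 2]. *)
  rewrite /M t0 add0r mulr1 !div1r lef_pV2 ?posrE ?sqrtr_gt0//.
  rewrite -(@ler_pXn2r _ 2) ?nnegrE ?sqrtr_ge0// sqr_sqrtr//.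
  by rewrite -natrX ler_nat.
have [q qP] := middle_rounding (fun k => f (k%:R / n%:R)) t0 tn.
(* The floors equal [f 0] and [f 1], which are integers. Nodes in the outer blocks lie within
   [t / n] of their endpoint, so the error there is at most [A]. *)
pose q' k := if (k < t)%N then Num.floor (f 0) else
             if (k < (n - t).+1)%N then q k else Num.floor (f 1).
exists q' => x x01.
have tnR : 0 <= t%:R / n%:R :> R by rewrite divr_ge0.
have k01 k : (k <= n)%N -> 0 <= (k%:R / n%:R : R) <= 1.
  by move=> kn; rewrite divr_ge0//= ler_pdivrMr// mul1r ler_nat.
pose e k := (f (k%:R / n%:R) - (q' k)%:~R) * bern n k x.
have edge a b : (forall k, (a <= k < b)%N ->
    `|f (k%:R / n%:R) - (q' k)%:~R| <= A) ->
    `|\sum_(a <= k < b) e k| <= Num.max A B * \sum_(a <= k < b) bern n k x.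
  move=> H; apply: le_trans (ler_norm_sum _ _ _) _.
  rewrite mulr_sumr; apply: ler_sum_nat => k kab.
  rewrite normrM (ger0_norm (bern_ge0 _ _ x01)).
  by apply: ler_wpM2r; [exact: bern_ge0 | rewrite le_max H].
have split3 (F : nat -> R) : \sum_(k < n.+1) F k = \sum_(0 <= k < t) F k +
    (\sum_(t <= k < (n - t).+1) F k + \sum_((n - t).+1 <= k < n.+1) F k).
  rewrite -(big_mkord xpredT F) (@big_cat_nat _ _ _ t)//=; last by lia.
  by rewrite (@big_cat_nat _ _ _ (n - t).+1 t)//=; lia.
have := bern_sum n x; rewrite (split3 (fun k => bern n k x)) => S1.
rewrite (split3 e).
have mid : `|\sum_(t <= k < (n - t).+1) e k| <=
    Num.max A B * \sum_(t <= k < (n - t).+1) bern n k x + M.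
  have -> : \sum_(t <= k < (n - t).+1) e k =
     \sum_(t <= k < (n - t).+1) (f (k%:R / n%:R) - (q k)%:~R) * bern n k x.
    apply: eq_big_nat => k /andP[tk kn].
    by rewrite /e /q' ltnNge tk/= kn.
  apply: le_trans (qP x x01) _; rewrite lerD2r; apply: ler_wpM2r.
    by apply: sumr_ge0 => k _; exact: bern_ge0.
  by rewrite le_max lexx orbT.
have lo : `|\sum_(0 <= k < t) e k| <= Num.max A B * \sum_(0 <= k < t) bern n k x.
  apply: edge => k /= kt; rewrite /q' kt floorK//.
  apply: le_modcont => //; [by apply: k01; lia|by rewrite lexx ler01|].
  by rewrite subr0 ger0_norm ?divr_ge0// ler_pM2r ?invr_gt0// ler_nat ltnW.
have hi : `|\sum_((n - t).+1 <= k < n.+1) e k| <=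
    Num.max A B * \sum_((n - t).+1 <= k < n.+1) bern n k x.
  apply: edge => k /andP[kt kn].
  have -> : q' k = Num.floor (f 1).
    by rewrite /q' ifF ?ifF//; lia.
  rewrite floorK//.
  apply: le_modcont => //; [by apply: k01|by rewrite lexx ler01|].
  have -> : k%:R / n%:R - 1 = - ((n - k)%:R / n%:R) :> R.
    by rewrite natrB//; field; rewrite gt_eqF.
  rewrite normrN ger0_norm ?divr_ge0// ler_pM2r ?invr_gt0// ler_nat; lia.
move: S1 lo mid hi.
move: (\sum_(0 <= k < t) bern n k x) (\sum_(t <= k < _) bern n k x).
move: (\sum_((n - t).+1 <= k < _) bern n k x) => p3 p1 p2 S1 lo mid hi.
apply: le_trans (ler_normD _ _) _.
have := ler_normD (\sum_(t <= k < (n - t).+1) e k)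
  (\sum_((n - t).+1 <= k < n.+1) e k).
(* The weights of the three blocks add up to 1, so the maximum is paid only once. *)
have E : Num.max A B + M = Num.max A B * (p1 + (p2 + p3)) + M.
  by rewrite S1 mulr1.
rewrite E; lra.
Qed.

(** * Distance to the lattice and the minimum [rho] *)

(** Supplies the lower bound that makes the infimum over the lattice meaningful. For arbitrary [g]
    and [h] the supremum may not exist, and [sup] is then 0. *)
Lemma dinf_ge0 (R : realType) (g h : R -> R) : 0 <= dinf g h.
Proof.
rewrite /dinf; set E := [set _ | _ in _].
have [sE|/sup_out ->//] := pselect (has_sup E).
apply: (@le_trans _ _ `|g 0 - h 0|) => //.
by apply: ub_le_sup; [exact: sE.2 | exists 0 => //=; rewrite in_itv/= lexx ler01].
Qed.

Lemma dinf_set_le (R : realType) (f P : R -> R) (S : set (R -> R)) (c : R) :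
  S P -> (forall x, 0 <= x <= 1 -> `|f x - P x| <= c) -> dinf_set f S <= c.
Proof.
move=> SP H; apply: (@le_trans _ _ (dinf f P)).
  apply: ge_inf; last by exists P.
  by exists 0 => _ [Q _ <-]; exact: dinf_ge0.
apply: ge_sup.
  by exists `|f 0 - P 0|, 0 => //=; rewrite in_itv/= lexx ler01.
by move=> _ [x /= + <-]; rewrite in_itv/=; exact: H.
Qed.

Lemma dinf_set_le_rho_term (R : realType) (f : R -> R) (n t : nat) :
  {within `[0, 1], continuous f} ->
  f 0 \is a Num.int -> f 1 \is a Num.int -> (0 < n)%N -> (2 * t <= n)%N ->
  dinf_set f (@bernstein_lattice R n)
    <= 5 / 4 * modcont f (1 / Num.sqrt n%:R) + rho_term f n t.
Proof.
move=> cf f0 f1 n0 tn; have [q qP] := lattice_rounding cf f0 f1 n0 tn.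
apply: (dinf_set_le (P := fun x => \sum_(k < n.+1) (q k)%:~R * bern n k x)).
  by exists (fun k : 'I_n.+1 => q k).
move=> x x01; have A := bernstein_approx cf n0 x01; have B := qP x x01.
have -> : f x - \sum_(k < n.+1) (q k)%:~R * bern n k x =
   (f x - \sum_(k < n.+1) f (k%:R / n%:R) * bern n k x) +
   \sum_(k < n.+1) (f (k%:R / n%:R) - (q k)%:~R) * bern n k x.
  have -> : \sum_(k < n.+1) (f (k%:R / n%:R) - (q k)%:~R) * bern n k x =
    \sum_(k < n.+1) f (k%:R / n%:R) * bern n k x -
    \sum_(k < n.+1) (q k)%:~R * bern n k x.
    by rewrite -sumrB; apply: eq_bigr => k _; ring.
  by ring.
by apply: le_trans (ler_normD _ _) _; exact: lerD.
Qed.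

Lemma rho_term_ge0 (R : realType) (f : R -> R) (n t : nat) :
  (2 * t <= n)%N -> 0 <= rho_term f n t.
Proof.
move=> tn; have : (2 * t)%:R <= n%:R :> R by rewrite ler_nat.
rewrite natrM => H; rewrite /rho_term addr_ge0 ?divr_ge0 ?sqrtr_ge0//.
by rewrite le_max; apply/orP; right; rewrite divr_ge0//; lra.
Qed.

Lemma rho_le_term (R : realType) (f : R -> R) (n t : nat) :
  (2 * t <= n)%N -> rho f n <= rho_term f n t.
Proof.
move=> tn; apply: ge_inf; last by exists t.
by exists 0 => _ [s /= sn <-]; exact: rho_term_ge0.
Qed.

Lemma le_rho (R : realType) (f : R -> R) (n : nat) (c : R) :
  (forall t, (2 * t <= n)%N -> c <= rho_term f n t) -> c <= rho f n.
Proof.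
move=> H; apply: lb_le_inf; first by exists (rho_term f n 0), 0%N.
by move=> _ [t /= tn <-]; exact: H.
Qed.

(** * Cube-root bounds and conclusion *)

(** Replaces real powers by [s] with [s^3 = n], so that the remaining estimates are polynomial in
    [s]. *)
Lemma cube_rootP (R : realType) (n : nat) : (0 < n)%N ->
  exists s : R, [/\ 1 <= s, s ^+ 3 = n%:R & n%:R `^ (- (1 / 3)) = s^-1].
Proof.
move=> n0; exists (n%:R `^ (1 / 3)).
have E : (n%:R `^ (1 / 3)) ^+ 3 = n%:R :> R.
  rewrite -powR_mulrn ?powR_ge0// -powRrM.
  by rewrite (_ : 1 / 3 * 3%:R = 1) ?powRr1//; field.
split=> //; last by rewrite powRN.
rewrite leNgt; apply/negP => s1.
have : (n%:R `^ (1 / 3)) ^+ 3 < 1 :> R by rewrite exprn_ilt1 ?powR_ge0.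
by rewrite E ltrn1 ltnNge n0.
Qed.

(* The minimum is tested at [t = floor (n^(2/3) / 2)]. *)
Lemma rho_le (R : realType) (f : R -> R) (n : nat) :
  {within `[0, 1], continuous f} -> (0 < n)%N ->
  rho f n <= modcont f (1 / 2 * n%:R `^ (- (1 / 3)))
             + 2 * n%:R `^ (- (1 / 3)).
Proof.
move=> cf n0; have [s [s1 s3 ->]] := cube_rootP R n0.
have s0 : 0 < s by apply: lt_le_trans s1.
have y0 : 0 <= s ^+ 2 / 2 by rewrite divr_ge0// sqr_ge0.
pose t := Num.truncn (s ^+ 2 / 2).
have /andP[ty yt] := truncn_itv y0; rewrite -/t in ty yt.
rewrite -(natr1 t) in yt.
have s23 : s ^+ 2 <= n%:R by rewrite -s3; nra.
have tn : (2 * t <= n)%N by rewrite -(ler_nat R) natrM; lra.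
apply: le_trans (rho_le_term f tn) _; rewrite /rho_term.
have sV0 : 0 < s^-1 by rewrite invr_gt0.
have tn2 : t%:R / n%:R <= 1 / 2 * s^-1.
  rewrite -s3 ler_pdivrMr ?exprn_gt0//.
  by rewrite (_ : 1 / 2 * s^-1 * s ^+ 3 = s ^+ 2 / 2)//; field; rewrite gt_eqF.
have tn0 : 0 <= t%:R / n%:R :> R by rewrite divr_ge0.
have W := modcont_le cf tn0 tn2.
have W0 := modcont_ge0 cf (le_trans tn0 tn2).
(* From [2t <= s^2] and [s >= 1]: [n + 1 - 2t >= s^2 (s - 1) + 1 >= s]. *)
have B : 1 / (2 * (n%:R + 1 - 2 * t%:R)) <= s^-1.
  have : s <= 2 * (n%:R + 1 - 2 * t%:R) by rewrite -s3; nra.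
  by move=> H; rewrite div1r lef_pV2 ?posrE//; lra.
(* Since [t] is the floor of [s^2 / 2], [2 (t + 1) > s^2]. *)
have M : 1 / Num.sqrt (2 * (t%:R + 1)) <= s^-1.
  have t1 : 0 < 2 * (t%:R + 1) :> R by rewrite mulr_gt0// natr1 ltr0n.
  rewrite div1r lef_pV2 ?posrE ?sqrtr_gt0// -(ger0_norm (ltW s0)) -sqrtr_sqr.
  by rewrite ler_sqrt//; lra.
have : Num.max (modcont f (t%:R / n%:R)) (1 / (2 * (n%:R + 1 - 2 * t%:R)))
    <= modcont f (1 / 2 * s^-1) + s^-1.
  by rewrite ge_max; apply/andP; split; lra.
by move: M; lra.
Qed.

Theorem mainTheorem1 (R : realType) (f : R -> R) (n : nat) :
  {within `[0, 1], continuous f} ->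
  f 0 \is a Num.int -> f 1 \is a Num.int ->
  (0 < n)%N ->
  [/\ dinf_set f (@bernstein_lattice R n)
        <= 5 / 4 * modcont f (1 / Num.sqrt n%:R) + rho f n,
      rho f n <= modcont f (1 / 2 * n%:R `^ (- (1 / 3)))
                 + 2 * n%:R `^ (- (1 / 3))
    & dinf_set f (@bernstein_lattice R n)
        <= 9 / 4 * modcont f (n%:R `^ (- (1 / 3))) + 2 * n%:R `^ (- (1 / 3))].
Proof.
move=> cf f0 f1 n0.
have D : dinf_set f (@bernstein_lattice R n)
    <= 5 / 4 * modcont f (1 / Num.sqrt n%:R) + rho f n.
  rewrite -lerBlDl; apply: le_rho => t tn.
  by rewrite lerBlDl; exact: dinf_set_le_rho_term.
have Q := rho_le cf n0.
split=> //; move: Q; have [s [s1 s3 ->]] := cube_rootP R n0 => Q.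
have s0 : 0 < s by apply: lt_le_trans s1.
have sV0 : 0 < s^-1 by rewrite invr_gt0.
(* As [s^2 <= s^3 = n], both [n^(-1/2)] and [n^(-1/3) / 2] are at most [n^(-1/3)]; monotonicity of
   the modulus gives [5/4 + 1 = 9/4]. *)
have sn : s <= Num.sqrt n%:R.
  rewrite -(ger0_norm (ltW s0)) -sqrtr_sqr ler_sqrt ?ler0n//.
  by rewrite -s3; nra.
have d1 : 1 / Num.sqrt n%:R <= s^-1.
  by rewrite div1r lef_pV2 ?posrE ?sqrtr_gt0 ?ltr0n.
have d2 : 1 / 2 * s^-1 <= s^-1 by lra.
have W1 := modcont_le cf (divr_ge0 ler01 (sqrtr_ge0 _)) d1.
have h0 : 0 <= 1 / 2 * s^-1 by lra.
have W2 := modcont_le cf h0 d2.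
lra.
Qed.
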